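(* Let $(X,d)$ be a metric space such that for each decreasing sequence $\{K_n\}_{n\ge 1}$ of nonempty closed bounded subsets of $X$ with $\hat d(K_n)\to 0$ as $n\to\infty$, one has $\bigcap_{n=1}^{\infty} K_n\neq\emptyset$. Then $X$ is complete.
   Context: A sequence $\{K_n\}$ of subsets of $X$ is decreasing if $K_{n+1}\subset K_n$ for all $n\in\mathbb N$ (not necessarily strictly). For $A\subset X$, $\hat d(A)=\sup_{x\in A} d(x,X\setminus A)$, where $d(x,B)=\inf_{y\in B}d(x,y)$ for nonempty $B\subset X$, and by convention $d(x,\emptyset)=\sup\{d(x,B):\emptyset\ne B\subset X\}=\sup_{y\in X}d(x,y)$ (relevant only when $A=X$). *)

(* Defs.v *)
From HB Require Import structures.
From mathcomp Require Import all_boot all_order all_algebra.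
From mathcomp Require Import all_classical all_reals all_analysis.

Set Implicit Arguments.
Unset Strict Implicit.
Unset Printing Implicit Defensive.

Import Order.TTheory GRing.Theory Num.Theory.

Local Open Scope classical_set_scope.
Local Open Scope ring_scope.

Section MetricNotions.
Context {R : realType} {X : metricType R}.
Implicit Types (x : X) (A B : set X).

(* [bounded_set] of the library is restricted to normed modules. *)
Definition metric_bounded A :=
  exists M : R, forall x y, A x -> A y -> mdist x y <= M.

(* [completeType] only covers pointed spaces and cannot be used as a
   predicate on a given space. *)
Definition metric_complete :=
  forall u : nat -> X, cauchy (u @ \oo) -> exists l : X, u @ \oo --> l.

(* Distances to sets are extended reals, so that the suprema below exist also
   when X is unbounded. *)
Definition inf_dist x B : \bar R := ereal_inf [set (mdist x y)%:E | y in B].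

Definition dist_set x B : \bar R :=
  if B == set0 then ereal_sup [set inf_dist x C | C in [set C | C !=set0]]
  else inf_dist x B.

Definition dhat A : \bar R := ereal_sup [set dist_set x (~` A) | x in A].

Lemma dist_set0 x :
  dist_set x set0 = ereal_sup [set (mdist x y)%:E | y in [set: X]].
Proof.
rewrite /dist_set eqxx; apply/eqP; rewrite eq_le; apply/andP; split.
  apply: ge_ereal_sup => _ [C [y Cy] <-].
  apply: (@le_trans _ _ (mdist x y)%:E).
    by apply: ereal_inf_lbound; exists y.
  by apply: ereal_sup_ubound; exists y.
apply: ge_ereal_sup => _ [y _ <-].
apply: ereal_sup_ubound; exists [set y]; first by exists y.
by rewrite /inf_dist image_set1 ereal_inf1.
Qed.

End MetricNotions.

Arguments metric_complete {R} X.

(* Main.v *)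
Require Import Defs.
From mathcomp Require Import all_boot all_order all_algebra.
From mathcomp Require Import all_classical all_reals all_analysis.
From mathcomp Require Import lra.

Import Order.TTheory GRing.Theory Num.Theory.
Import numFieldNormedType.Exports.

Local Open Scope classical_set_scope.
Local Open Scope ring_scope.

(** If [u] is a Cauchy sequence without limit, then [f x = lim d(x, u_n)] is
    positive everywhere, has infimum [0], and satisfies
    [f x <= d(x, y) + f y] and [d(x, y) <= f x + f y].  Choose [v_n] with
    [f v_(n+1) <= f v_n / 2]. The sublevel sets [K_n = {f <= f v_(n+1)}] are
    nonempty, closed, bounded and decreasing, with empty intersection; since
    [v_n] is not in [K_n] and lies within [2 f v_n] of all its points,
    [dhat K_n <= 2 f v_n --> 0]. *)

Section LimitDistance.
Context {R : realType} {X : metricType R}.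
Implicit Types (u : nat -> X) (x y : X).

Lemma cauchy_near_center u : cauchy (u @ \oo) -> forall e : R, 0 < e ->
  exists x, \forall n \near \oo, mdist x (u n) < e.
Proof.
move=> /cauchyP uc e e0; have [x xP] := uc e e0.
by exists x; move: xP; rewrite ballEmdist.
Qed.

(** For Cauchy [u], this is the distance from [x] to the point that [u] defines in the completion of
    [X]. *)
Definition lim_mdist u x : R := lim (mdist x (u n) @[n --> \oo]).

(** By the triangle inequality, [mdist x (u n)] differs from [mdist x y] by at most [mdist y (u n)].
    A center [y] close to a tail of [u] thus shows that these real distances form a Cauchy
    sequence. *)
Lemma lim_mdist_cvg u x : cauchy (u @ \oo) ->
  mdist x (u n) @[n --> \oo] --> lim_mdist u x.
Proof.
move=> uc; apply: R_complete; apply: cauchy_exP => e e0.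
have [y yP] := cauchy_near_center u uc e e0.
exists (mdist x y); suff : \forall n \near \oo,
  ball (mdist x y) e (mdist x (u n)) by [].
apply: filterS yP => n yn; rewrite /ball /= ltr_distlC.
have := metric_triangle x y (u n); have := metric_triangle x (u n) y.
rewrite (metric_sym (u n) y) => h1 h2; apply/andP; split; lra.
Qed.

Lemma lim_mdist_ge0 u x : cauchy (u @ \oo) -> 0 <= lim_mdist u x.
Proof.
move=> uc; apply: limr_ge; first exact/cvgP/lim_mdist_cvg.
by apply: nearW => n; exact: mdist_ge0.
Qed.

Lemma lim_mdist_triangle u x y : cauchy (u @ \oo) ->
  lim_mdist u x <= mdist x y + lim_mdist u y.
Proof.
move=> uc; have cx := lim_mdist_cvg u x uc.
have cy : mdist x y + mdist y (u n) @[n --> \oo] --> mdist x y + lim_mdist u y.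
  by apply: cvgD; [exact: cvg_cst | exact: lim_mdist_cvg].
by apply: (ler_cvg_to cx cy); apply: nearW => n; exact: metric_triangle.
Qed.

Lemma mdist_le_lim_mdist u x y : cauchy (u @ \oo) ->
  mdist x y <= lim_mdist u x + lim_mdist u y.
Proof.
move=> uc; have cD : mdist x (u n) + mdist y (u n) @[n --> \oo] -->
    lim_mdist u x + lim_mdist u y by apply: cvgD; exact: lim_mdist_cvg.
apply: (ler_cvg_to (cvg_cst (mdist x y)) cD); apply: nearW => n.
by rewrite (metric_sym y); exact: metric_triangle.
Qed.

Lemma lim_mdist_small u (e : R) : cauchy (u @ \oo) -> 0 < e ->
  exists x, lim_mdist u x <= e.
Proof.
move=> uc e0; have [x xP] := cauchy_near_center u uc e e0.
exists x; apply: limr_le; first exact/cvgP/lim_mdist_cvg.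
by apply: filterS xP => n /ltW.
Qed.

Lemma lim_mdist_eq0 u x : cauchy (u @ \oo) -> lim_mdist u x = 0 ->
  u @ \oo --> x.
Proof.
move=> uc fx0; apply/metricType_numDomainType.cvgrPdist_lt => e e0.
have := lim_mdist_cvg u x uc; rewrite fx0 => /cvgrPdist_lt /(_ e e0).
by apply: filterS => n; rewrite sub0r normrN ger0_norm ?mdist_ge0.
Qed.

(** By [lim_mdist_triangle], a point at distance less than [e] from the sublevel set has value at
    most [r + e], for every [e > 0]. *)
Lemma closed_lim_mdist_le u (r : R) : cauchy (u @ \oo) ->
  closed [set x | lim_mdist u x <= r].
Proof.
move=> uc x xcl /=; apply/ler_addgt0Pr => e e0.
have [y [/= fy]] := xcl _ (nbhsx_ballx x e e0).
rewrite ballEmdist /= => xy.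
have := lim_mdist_triangle u x y uc; lra.
Qed.

Lemma dhat_ge0 (A : set X) : A !=set0 -> (0 <= dhat A)%E.
Proof.
have inf_ge0 x (B : set X) : (0 <= inf_dist x B)%E.
  by apply: le_ereal_inf_tmp => _ [y _ <-]; rewrite lee_fin mdist_ge0.
move=> [x Ax]; apply: (@le_trans _ _ (dist_set x (~` A))).
  rewrite /dist_set; case: ifP => // _.
  (* Here the complement is empty and [dist_set] is a supremum over nonempty sets; any one of them,
     such as [[set x]], bounds it below by a nonnegative value. *)
  apply: (le_trans (inf_ge0 x [set x])).
  by apply: ereal_sup_ubound; exists [set x] => //; exists x.
by apply: ereal_sup_ubound; exists x.
Qed.

(** The single point [y] keeps the complement nonempty, which excludes the convention for the empty
    set, and bounds the infimum for all [x] in [A] at once. *)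
Lemma dhat_le (A : set X) y (r : R) : ~ A y ->
  (forall x, A x -> mdist x y <= r) -> (dhat A <= r%:E)%E.
Proof.
move=> nAy Ay; apply: ge_ereal_sup => _ [x Ax <-].
rewrite /dist_set; case: ifPn => [/eqP A0|_].
  by have : (~` A) y by []; rewrite A0.
apply: (@le_trans _ _ (mdist x y)%:E); last by rewrite lee_fin Ay.
by apply: ereal_inf_lbound; exists y.
Qed.

End LimitDistance.

Theorem theorem4p5 (R : realType) (X : metricType R)
  (hX : forall K : nat -> set X,
      (forall n, K n.+1 `<=` K n) ->
      (forall n, K n !=set0 /\ closed (K n) /\ metric_bounded (K n)) ->
      dhat (K n) @[n --> \oo] --> 0%E ->
      \bigcap_n K n !=set0) :
  metric_complete X.
Proof.
move=> u uc; apply: contrapT => nl.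
pose f := lim_mdist u.
have f_gt0 x : 0 < f x.
  rewrite lt_def lim_mdist_ge0// andbT; apply/eqP => fx0.
  by apply: nl; exists x; exact: lim_mdist_eq0.
have /choice [g gP] : forall x, exists y, f y <= f x / 2.
  by move=> x; apply: lim_mdist_small; rewrite // divr_gt0.
pose v n := iter n g (u 0).
have vS n : f (v n.+1) <= f (v n) / 2 by exact: gP.
have v_lt n : f (v n.+1) < f (v n).
  by have := vS n; have := f_gt0 (v n); lra.
have v_le n : f (v n) <= geometric (f (u 0)) 2^-1 n.
  elim: n => [|n IH]; first by rewrite /= expr0 mulr1.
  by rewrite /= exprSr mulrA (le_trans (vS n))// ler_pM2r.
have v0 : f (v n) @[n --> \oo] --> 0.
  apply: (@squeeze_cvgr _ _ _ _ (fun=> 0) (geometric (f (u 0)) 2^-1)).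
  - by apply: nearW => n; rewrite v_le ltW.
  - exact: cvg_cst.
  - by apply: cvg_geometric; rewrite ger0_norm ?invf_lt1 ?ltr1n.
(* The shift to [n.+1] leaves [v n] outside [K n], as [dhat_le] requires. *)
pose K n := [set x | f x <= f (v n.+1)].
have [] := hX K.
- by move=> n x /= /le_trans; apply; exact/ltW/v_lt.
- move=> n; split; [|split].
  + by exists (v n.+1); exact: lexx.
  + exact: closed_lim_mdist_le.
  + exists (f (v n.+1) + f (v n.+1)) => x y /= Kx Ky.
    exact: le_trans (mdist_le_lim_mdist u x y uc) (lerD Kx Ky).
- apply: (@squeeze_cvge _ _ _ _ (cst 0%E) _ (fun n => (f (v n) *+ 2)%:E)).
  + apply: nearW => n; apply/andP; split.
      by apply: dhat_ge0; exists (v n.+1); exact: lexx.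
    apply: (@dhat_le _ _ _ (v n)); first by rewrite /K /= leNgt v_lt.
    move=> x /= Kx; apply: le_trans (mdist_le_lim_mdist u x (v n) uc) _.
    by rewrite mulr2n lerD2r (le_trans Kx)// ltW.
  + exact: cvg_cst.
  + apply: cvg_EFin; first exact: nearW.
    by rewrite -(mul0rn _ 2); apply: cvgMn.
(* A common point [x] satisfies [f x <= f (v n)] for all [n]; the limit contradicts [f_gt0]. *)
- move=> x Kx; suff : f x <= 0 by rewrite leNgt f_gt0.
  by apply: (cvgr_to_ge v0); apply: nearW => n;
     rewrite (le_trans (Kx n I))// ltW.
Qed.
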